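(* Let $X$ be a reflexive smooth Banach space over $\mathbb{C}$ and let $T\in B(X)$ be self-adjoint. Then $\mu(T^{n})=\mu(T)^{n}$ for all $n\in\mathbb{N}$.
   Context: $B(X)$ is the space of bounded linear operators on $X$, $S_X=\{x\in X:\|x\|=1\}$, $X^*$ is the space of bounded linear functionals on $X$. $\mathbb{N}$ is the set of natural numbers $\{1,2,3,\dots\}$. $X$ is smooth if every $x\in S_X$ admits a unique $x^*\in S_{X^*}$ with $x^*(x)=1$. The duality mapping $J:X\to X^*$ of a smooth Banach space assigns to each $x$ the unique functional $J(x)$ with $\|J(x)\|=\|x\|$ and $J(x)(x)=\|x\|^2$. For $T\in B(X)$ the transpose $T':X^*\to X^*$ is $(T'f)(x)=f(Tx)$. $T\in B(X)$ is self-adjoint if $T'\circ J=J\circ T$. The minimum modulus is $\mu(T)=\inf\{\|Tx\|:x\in S_X\}$. *)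

(* Defs.v *)
From HB Require Import structures.
From mathcomp Require Import all_boot all_order all_algebra.
From mathcomp Require Export complex.
From mathcomp Require Import all_classical all_reals all_analysis.
Import Order.TTheory GRing.Theory Num.Theory.
Import numFieldNormedType.Exports.

Set Implicit Arguments.
Unset Strict Implicit.
Unset Printing Implicit Defensive.

Local Open Scope classical_set_scope.
Local Open Scope ring_scope.
Local Open Scope complex_scope.

(* The scalar field is [R[i]] for [R : realType].  Norms over [R[i]] take their
   values in [R[i]] (they are nonnegative, hence real); [nrm] is the same norm
   as an element of [R], so that suprema and infima are available. *)

Section NormRe.
Context {R : realType} {V : normedModType R[i]}.
Implicit Types x y : V.

Definition nrm x : R := complex.Re `|x|.

Lemma nrmE x : `|x| = (nrm x)%:C.
Proof.
by rewrite /nrm RRe_real // normr_real.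
Qed.

Lemma nrm_ge0 x : 0 <= nrm x.
Proof. by have := normr_ge0 x; rewrite nrmE lecR. Qed.

Lemma nrmD x y : nrm (x + y) <= nrm x + nrm y.
Proof. by have := ler_normD x y; rewrite !nrmE -rmorphD lecR. Qed.

Lemma nrm0_eq0 x : nrm x = 0 -> x = 0.
Proof. by move=> x0; apply/normr0_eq0; rewrite nrmE x0. Qed.

Lemma nrm0 : nrm 0 = 0.
Proof. by rewrite /nrm normr0. Qed.

End NormRe.

Lemma normcE (R : realType) (l : R[i]) : `|l| = (nrm (l : R[i]^o))%:C.
Proof. exact: (nrmE (l : R[i]^o)). Qed.

Lemma nrmZ (R : realType) (V : normedModType R[i]) (l : R[i]) (x : V) :
  nrm (l *: x) = nrm (l : R[i]^o) * nrm x.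
Proof.
apply: (@complexI R); rewrite rmorphM /=.
by rewrite -(nrmE (l *: x)) -(nrmE x) -normcE normrZ.
Qed.

Section BoundedOperators.
Context {R : realType}.
Implicit Types X Y Z : normedModType R[i].

Definition bounded_linear X Y (f : X -> Y) : Prop :=
  linear f /\ exists M : R, forall x, `|f x| <= M%:C * `|x|.

Record bop X Y := Bop {
  bop_fun :> X -> Y;
  bop_subproof : `[< bounded_linear bop_fun >] }.

End BoundedOperators.

Section BopModule.
Context {R : realType} {X Y : normedModType R[i]}.

HB.instance Definition _ := [isSub for @bop_fun R X Y].
HB.instance Definition _ := [Choice of bop X Y by <:].

Lemma bopP (f : bop X Y) : bounded_linear f.
Proof. exact/asboolP/bop_subproof. Qed.

Lemma bounded_linear_closed :
  subsemimod_closed (fun f : X -> Y => `[< bounded_linear f >]).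
Proof.
have D (f g : X -> Y) : bounded_linear f -> bounded_linear g ->
    bounded_linear (f + g).
  move=> [lf [M hM]] [lg [N hN]]; split.
    move=> a u v; rewrite !addrfctE lf lg scalerDr.
    by rewrite addrACA.
  exists (M + N) => x; rewrite rmorphD mulrDl.
  exact: le_trans (ler_normD _ _) (lerD (hM x) (hN x)).
split; [split|].
- apply/asboolP; split; first by move=> a u v; rewrite /= scaler0 addr0.
  by exists 0 => x; rewrite normr0 mul0r.
- by move=> f g /asboolP hf /asboolP hg; apply/asboolP/D.
move=> a f /asboolP[lf [M hM]]; apply/asboolP; split.
  move=> b u v; rewrite !scalrfctE lf scalerDr !scalerA.
  by rewrite mulrC.
exists (nrm (a : R[i]^o) * M) => x.
rewrite scalrfctE normrZ rmorphM -mulrA normcE.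
by rewrite ler_wpM2l // lecR nrm_ge0.
Qed.

HB.instance Definition _ := GRing.SubChoice_isSubLmodule.Build
  R[i] (X -> Y) _ (bop X Y) bounded_linear_closed.

HB.instance Definition _ (f : bop X Y) :=
  GRing.isLinear.Build R[i] X Y _ (bop_fun f) (bopP f).1.

Definition opnorm (f : bop X Y) : R :=
  sup [set nrm (f x) | x in [set x | `|x| <= 1]].

Let ball_set (f : bop X Y) := [set nrm (f x) | x in [set x | `|x| <= 1]].

Let has_sup_ball (f : bop X Y) : has_sup (ball_set f).
Proof.
split; first by exists (nrm (f 0)), 0; rewrite /= ?normr0.
have [_ [M hM]] := bopP f; exists `|M| => _ [x x1 <-].
have : `|f x| <= `|M|%:C.
  apply: le_trans (hM x) _; rewrite nrmE -rmorphM /= lecR.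
  have x1' : nrm x <= 1 by move: x1; rewrite /= nrmE lecR.
  apply: le_trans (_ : `|M| * nrm x <= _).
    by rewrite ler_wpM2r ?nrm_ge0 ?ler_norm.
  by rewrite ler_piMr.
by rewrite nrmE lecR.
Qed.

Let opnorm_ub (f : bop X Y) x : `|x| <= 1 -> nrm (f x) <= opnorm f.
Proof.
by move=> x1; apply: ub_le_sup; [exact: (has_sup_ball f).2 | exists x].
Qed.

Let opnorm_ge0 (f : bop X Y) : 0 <= opnorm f.
Proof. by apply: le_trans (nrm_ge0 (f 0)) (opnorm_ub f _); rewrite normr0. Qed.

Lemma opnormP (f : bop X Y) x : nrm (f x) <= opnorm f * nrm x.
Proof.
have [->|x0] := eqVneq x 0; first by rewrite linear0 !nrm0 mulr0.
have nx : 0 < nrm x.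
  by rewrite lt_neqAle nrm_ge0 andbT eq_sym; apply: contra_neq x0 => /nrm0_eq0.
have e1 : nrm (((nrm x)^-1)%:C : R[i]^o) = (nrm x)^-1.
  by rewrite /nrm normc_def /= expr0n addr0 sqrtr_sqr ger0_norm ?invr_ge0 ?nrm_ge0.
have := opnorm_ub f (_ : `|((nrm x)^-1)%:C *: x| <= 1).
rewrite nrmE nrmZ e1 mulVf ?gt_eqF // lexx => /(_ isT).
by rewrite linearZ /= nrmZ e1 mulrC ler_pdivrMr.
Qed.

Let opnorm_le (f : bop X Y) (M : R) :
  (forall x, `|x| <= 1 -> nrm (f x) <= M) -> opnorm f <= M.
Proof.
move=> h; apply: ge_sup; first exact: (has_sup_ball f).1.
by move=> _ [x x1 <-]; exact: h.
Qed.

Let norm (f : bop X Y) : R[i] := (opnorm f)%:C.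

Let ler_norm_bop (f g : bop X Y) : norm (f + g) <= norm f + norm g.
Proof.
rewrite -rmorphD lecR; apply: opnorm_le => x x1.
by apply: le_trans (nrmD _ _) _; rewrite lerD ?opnorm_ub.
Qed.

Let opnormZ_le l (f : bop X Y) :
  opnorm (l *: f) <= nrm (l : R[i]^o) * opnorm f.
Proof.
apply: opnorm_le => x x1.
by rewrite (_ : (l *: f) x = l *: f x) // nrmZ ler_wpM2l ?nrm_ge0 ?opnorm_ub.
Qed.

Let normZ l (f : bop X Y) : norm (l *: f) = `|l| * norm f.
Proof.
rewrite normcE /norm -rmorphM; congr (_ %:C).
apply/eqP; rewrite eq_le opnormZ_le /=.
have [->|l0] := eqVneq l 0; first by rewrite nrm0 mul0r opnorm_ge0.
have nl : 0 < nrm (l : R[i]^o).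
  by rewrite lt_neqAle nrm_ge0 andbT eq_sym; apply: contra_neq l0 => /nrm0_eq0.
have := opnormZ_le l^-1 (l *: f); rewrite scalerA mulVf // scale1r.
have -> : nrm (l^-1 : R[i]^o) = (nrm (l : R[i]^o))^-1.
  by apply: (@complexI R); rewrite fmorphV /= -!normcE normfV.
by rewrite ler_pdivlMl.
Qed.

Let norm0_eq0 (f : bop X Y) : norm f = 0 -> f = 0.
Proof.
move=> /complexI f0; apply/val_inj/funext => x; apply: nrm0_eq0.
by apply/eqP; rewrite eq_le nrm_ge0 andbT; have := opnormP f x; rewrite f0 mul0r.
Qed.

HB.instance Definition _ := @Lmodule_isNormed.Build R[i] (bop X Y)
  norm ler_norm_bop normZ norm0_eq0.


End BopModule.
Section Duality.
Context {R : realType}.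
Implicit Types X : normedModType R[i].

Definition dual X := bop X (R[i]^o).

(* Every bounded functional on the dual is an evaluation, i.e. the canonical
   isometry from [X] to its bidual is onto. *)
Definition reflexive_space X : Prop :=
  forall Phi : dual (dual X), exists x : X, forall f : dual X, Phi f = f x.

Definition smooth_space X : Prop :=
  forall x : X, `|x| = 1 -> exists! f : dual X, `|f| = 1 /\ f x = 1.

(* Meaningful when [X] is smooth: the conditions then determine a unique
   functional. *)
Definition duality_map X (x : X) : dual X :=
  xget 0 [set f : dual X | `|f| = `|x| /\ f x = `|x| ^+ 2].

Lemma bounded_linear_comp (X Y Z : normedModType R[i])
    (g : bop Y Z) (f : bop X Y) : `[< bounded_linear (g \o f) >].
Proof.
have [_ [N hN]] := bopP g; have [_ [M hM]] := bopP f.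
apply/asboolP; split; first by move=> a u v /=; rewrite !linearP.
exists (`|N| * M) => x /=; apply: le_trans (hN _) _.
apply: le_trans (_ : `|N|%:C * `|f x| <= _).
  by rewrite ler_wpM2r // lecR ler_norm.
by rewrite rmorphM -mulrA ler_wpM2l // lecR.
Qed.

Definition bop_comp (X Y Z : normedModType R[i])
  (g : bop Y Z) (f : bop X Y) : bop X Z := Bop (bounded_linear_comp g f).

Lemma bounded_linear_id X : `[< bounded_linear (@idfun X) >].
Proof. by apply/asboolP; split=> //; exists 1 => x; rewrite mul1r. Qed.

Definition bop_id X : bop X X := Bop (bounded_linear_id X).

Definition bop_exp X (T : bop X X) (n : nat) : bop X X :=
  iter n (bop_comp T) (bop_id X).

Definition transpose X (T : bop X X) : dual X -> dual X :=
  fun f => bop_comp f T.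

Definition selfadjoint X (T : bop X X) : Prop :=
  transpose T \o @duality_map X = @duality_map X \o T.

(* With the library convention [inf set0 = 0], this is [0] on the zero space. *)
Definition min_modulus X (T : bop X X) : R :=
  inf [set nrm (T x) | x in [set x : X | `|x| = 1]].

End Duality.

(* Main.v *)
Require Import Defs.
From mathcomp Require Import all_boot all_order all_algebra.
From mathcomp Require Import complex.
From mathcomp Require Import all_classical all_reals all_analysis.
From mathcomp Require Import ring lra.
Import Order.TTheory GRing.Theory Num.Theory.
Import numFieldNormedType.Exports.
Local Open Scope ring_scope.
Local Open Scope complex_scope.

(** The heart of the matter is that self-adjointness makes the orbit norms
    log-convex.  Evaluating [J (T x) = J x \o T] at [T x] gives
    [|T x|^2 = J x (T (T x)) <= |x| * |T (T x)|], so along any orbit the ratios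
    [|T^(k+1) z| / |T^k z|] are nondecreasing in [k]
    ([selfadjoint_log_convex]).

    The inequality [mu (T^n) >= mu T ^ n] holds for every operator.  For the
    converse, log-convexity says that if the last of the first [n] ratios is
    at most [l], then all of them are, whence [|T^n z| <= l^n * |z|]
    ([log_convex_growth]) and [mu (T^n) <= l^n].  So for each [l > mu T] one
    needs an orbit whose [n]-th ratio is at most [l], that is, a vector
    [T^(n-1) z] which is nearly optimal for [mu T].  Nearly optimal unit
    vectors exist, and they can be moved into the range of [T^(n-1)] as soon
    as [T] has dense range ([near_minimizer_in_range]).

    If [T] kills a nonzero vector, both sides vanish.  If [T] is injective, its
    range is dense ([selfadjoint_dense]): a nonzero functional [f] vanishing on
    the range attains its norm, by reflexivity, so up to a scalar it is [J x]
    for some unit [x], by smoothness; then [J (T x) = J x \o T = 0] forces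
    [T x = 0], hence [x = 0].

    Norm attainment and the passage from trivial annihilator to density both
    come from one form of the complex Hahn-Banach theorem
    ([seminorm_hahn_banach]): for every seminorm [p] and point [v0] there is a
    linear functional dominated by [p] and equal to [p v0] at [v0].  It is
    applied to the norm of the dual and to the distance to the range. *)

(** * Hahn-Banach theorem *)

Lemma nrm_real {R : realType} (c : R) : nrm (c%:C : R[i]^o) = `|c|.
Proof. by rewrite /nrm normc_def /= expr0n addr0 sqrtr_sqr. Qed.

Lemma nrm_gt0 {R : realType} {X : normedModType R[i]} (x : X) :
  (0 < nrm x) = (x != 0).
Proof. by rewrite -ltcR -nrmE normr_gt0. Qed.

(** Real scalars act through [%:C], so that a complex space also serves as a
    real one without a change of carrier.  Homogeneity is asked as an
    inequality, which is easier to establish; equality follows, see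
    [sublinearZ]. *)
Definition sublinear {R : realType} {V : lmodType R[i]} (q : V -> R) : Prop :=
  (forall x y, q (x + y) <= q x + q y) /\
  (forall (c : R) x, 0 <= c -> q (c%:C *: x) <= c * q x).

Lemma sublinear0 {R : realType} {V : lmodType R[i]} (q : V -> R) :
  sublinear q -> q 0 = 0.
Proof.
move=> [qD qZ]; apply/eqP; rewrite eq_le; apply/andP; split.
  by have := qZ 0 0 (lexx _); rewrite scaler0 mul0r.
by have := qD 0 0; rewrite addr0 -{1}[q 0]addr0 lerD2l.
Qed.

Lemma sublinear_geN {R : realType} {V : lmodType R[i]} (q : V -> R) :
  sublinear q -> forall x, - q (- x) <= q x.
Proof.
move=> sq x; have := sq.1 x (- x).
by rewrite subrr sublinear0 // -lerBlDr sub0r.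
Qed.

(** The pointwise infimum of a chain is finite because each member satisfies
    [q x >= - q (- x) >= - p (- x)], and it is subadditive because two members
    of a chain can be replaced by the smaller one. *)
Lemma sublinear_chain_inf {R : realType} {V : lmodType R[i]}
    (p : V -> R) (A : set (V -> R)) :
  (A !=set0)%classic ->
  (forall q, A q -> sublinear q /\ forall x, q x <= p x) ->
  (forall q r, A q -> A r ->
    (forall x, q x <= r x) \/ (forall x, r x <= q x)) ->
  exists m, sublinear m /\ forall q, A q -> forall x, m x <= q x.
Proof.
move=> [q0 Aq0] subA chA.
pose E x := [set q x | q in A]%classic.
have lbE x : has_lbound (E x).
  exists (- p (- x)) => _ [q Aq <-]; have [sq qp] := subA _ Aq.
  by apply: le_trans (sublinear_geN _ sq x); rewrite lerN2.
have E0 x : (E x !=set0)%classic by exists (q0 x), q0.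
have mA q x : A q -> inf (E x) <= q x.
  by move=> Aq; apply: ge_inf => //; exists q.
exists (fun x => inf (E x)); split; last by move=> q Aq x; exact: mA.
split=> [x y|c x].
  rewrite -lerBlDr; apply: lb_le_inf => // _ [q Aq <-].
  rewrite lerBlDr -lerBlDl; apply: lb_le_inf => // _ [r Ar <-].
  rewrite lerBlDl.
  have [qr|rq] := chA _ _ Aq Ar.
    apply: le_trans (mA q _ Aq) _; apply: le_trans ((subA _ Aq).1.1 _ _) _.
    by rewrite lerD2l.
  apply: le_trans (mA r _ Ar) _; apply: le_trans ((subA _ Ar).1.1 _ _) _.
  by rewrite lerD2r.
rewrite le_eqVlt => /predU1P[<-|c0].
  rewrite mul0r scale0r; apply: le_trans (mA q0 _ Aq0) _.
  by rewrite sublinear0 //; exact: (subA _ Aq0).1.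
rewrite -ler_pdivrMl //; apply: lb_le_inf => // _ [q Aq <-].
rewrite ler_pdivrMl //; apply: le_trans (mA q _ Aq) _.
by apply: (subA _ Aq).1.2; exact: ltW.
Qed.

Lemma sublinearZ {R : realType} {V : lmodType R[i]} (q : V -> R) :
  sublinear q -> forall (c : R) x, 0 <= c -> q (c%:C *: x) = c * q x.
Proof.
move=> sq c x; rewrite le_eqVlt => /predU1P[<-|c0].
  by rewrite mul0r scale0r sublinear0.
apply/eqP; rewrite eq_le (sq.2 c x (ltW c0)) /= -ler_pdivlMl //.
have := sq.2 c^-1 (c%:C *: x); rewrite scalerA -rmorphM /= mulVf ?gt_eqF //.
by rewrite scale1r => -> //; rewrite invr_ge0 ltW.
Qed.

(** The witness is the infimum over [t >= 0] of [q (x + t v) - t * q v]; the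
    values [t = 0] and [t = 1] give the two bounds.  It lowers [q] as far as
    possible in the direction [- v].  A minimal [q] must therefore satisfy
    [q x + q v <= q (x + v)], that is, be additive. *)
Lemma sublinear_tilt {R : realType} {V : lmodType R[i]} (q : V -> R) (v : V) :
  sublinear q ->
  exists r, sublinear r /\ forall x, r x <= q x /\ r x <= q (x + v) - q v.
Proof.
move=> sq; have [qD qZ] := sq.
pose E x :=
  [set q (x + t%:C *: v) - t * q v | t in [set t : R | 0 <= t]]%classic.
have lbE x : has_lbound (E x).
  exists (- q (- x)) => _ [t /= t0 <-].
  rewrite lerBrDr -(sublinearZ q) // addrC lerBlDr -[X in q X](addrK x) addrC.
  by rewrite [_ + x]addrC addrC; apply: qD.
have rE x t : 0 <= t -> inf (E x) <= q (x + t%:C *: v) - t * q v.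
  by move=> t0; apply: ge_inf => //; exists t.
have E0 x : (E x !=set0)%classic.
  by exists (q (x + 0%:C *: v) - 0 * q v), 0 => /=.
exists (fun x => inf (E x)); split; last first.
  move=> x; split.
    by have := rE x 0 (lexx _); rewrite scale0r addr0 mul0r subr0.
  by have := rE x 1 ler01; rewrite scale1r mul1r.
split=> [x y|c x].
  rewrite -lerBlDr; apply: lb_le_inf => // _ [s s0 <-].
  rewrite lerBlDr -lerBlDl; apply: lb_le_inf => // _ [t t0 <-].
  rewrite lerBlDl; apply: le_trans (rE _ (s + t) _) _; first exact: addr_ge0.
  rewrite rmorphD /= scalerDl addrACA mulrDl opprD [leRHS]addrACA lerD2r.
  exact: qD.
rewrite le_eqVlt => /predU1P[<-|c0].
  rewrite mul0r scale0r; apply: le_trans (rE _ 0 (lexx _)) _.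
  by rewrite scale0r addr0 mul0r subr0 sublinear0.
rewrite -ler_pdivrMl //; apply: lb_le_inf => // _ [t t0 <-].
rewrite ler_pdivrMl //; apply: le_trans (rE _ (c * t) _) _.
  by rewrite mulr_ge0 // ltW.
rewrite rmorphM /= -scalerA -scalerDr mulrBr mulrA lerD2r.
by apply: qZ; exact: ltW.
Qed.

(** A minimal sublinear functional below [p] is linear.  To control its value
    at [v0], minimize not below [p] but below the tilt [p'] of [p] along [v0]:
    since [p' (- v0) <= - p v0], every linear functional below [p'] is at least
    [p v0] at [v0]. *)
Lemma real_hahn_banach {R : realType} {V : lmodType R[i]} (p : V -> R)
    (v0 : V) :
  sublinear p ->
  exists u : V -> R,
    [/\ forall x y, u (x + y) = u x + u y,
        forall (c : R) x, u (c%:C *: x) = c * u x,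
        forall x, u x <= p x & u v0 = p v0].
Proof.
move=> sp; have [p' [sp' p'p]] := sublinear_tilt p v0 sp.
pose T := {q : V -> R | sublinear q /\ forall x, q x <= p' x}.
(* Zorn's lemma yields maximal elements, so the order is reversed. *)
pose le (q r : T) : bool := `[< forall x, sval r x <= sval q x >].
have [|||A chA|[u [su up]] minu] := @Zorn T le.
- by move=> q; apply/asboolP.
- move=> q r s /asboolP rq /asboolP sr; apply/asboolP => x.
  exact: le_trans (sr x) (rq x).
- move=> [q hq] [r hr] /asboolP /= rq /asboolP /= qr; apply: eq_exist => /=.
  by apply/funext => x; apply/eqP; rewrite eq_le qr rq.
- have [[q0 Aq0]|noA] := pselect (A !=set0)%classic; last first.
    exists (exist _ p' (conj sp' (fun x => lexx _))) => q Aq.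
    by exfalso; apply: noA; exists q.
  have [||q r|m [sm mA]] :=
      @sublinear_chain_inf R V p' [set sval q | q in A]%classic.
  + by exists (sval q0), q0.
  + by move=> _ [q _ <-]; exact: svalP q.
  + move=> [q' Aq' <-] [r' Ar' <-].
    by have [/asboolP|/asboolP] := chA _ _ Aq' Ar'; [right|left].
  have mp' x : m x <= p' x.
    by apply: le_trans (mA (sval q0) _ x) _; [exists q0|exact: (svalP q0).2].
  exists (exist _ m (conj sm mp')) => q Aq; apply/asboolP => x /=.
  by apply: mA; exists q.
have uD x y : u (x + y) = u x + u y.
  apply/eqP; rewrite eq_le su.1 /=.
  have [r [sr ru]] := sublinear_tilt u y su.
  have rp' z : r z <= p' z by exact: le_trans (ru z).1 (up z).
  have /(congr1 sval) /= ruE :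
      exist _ r (conj sr rp') = exist _ u (conj su up) :> T.
    by apply: minu; apply/asboolP => z /=; exact: (ru z).1.
  by rewrite -lerBrDr; rewrite -{1}ruE; exact: (ru x).2.
have uN x : u (- x) = - u x.
  by apply/eqP; rewrite -addr_eq0 -uD addNr sublinear0.
have ulp x : u x <= p x by exact: le_trans (up x) (p'p x).1.
exists u; split=> //.
  move=> c x; have [c0|c0] := leP 0 c; first exact: sublinearZ.
  rewrite -[c]opprK rmorphN /= scaleNr uN sublinearZ ?mulNr // oppr_ge0.
  exact: ltW.
apply/eqP; rewrite eq_le ulp /= -lerN2 -uN.
apply: le_trans (up _) _; apply: le_trans (p'p _).2 _.
by rewrite addNr sublinear0 // sub0r.
Qed.

(** A real functional [u] is the real part of the complex functional
    [u x - i u (i x)].  A rotation turning [f x] into [|f x|] transfers the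
    bound on [u] to a bound on the modulus of [f]; and a complex number whose
    modulus does not exceed its real part is real, whence the value at [v0]. *)
Lemma seminorm_hahn_banach {R : realType} {V : lmodType R[i]} (p : V -> R)
    (v0 : V) :
  (forall x y, p (x + y) <= p x + p y) ->
  (forall (l : R[i]) x, p (l *: x) <= nrm (l : R[i]^o) * p x) ->
  exists f : V -> R[i]^o,
    [/\ linear f, forall x, nrm (f x) <= p x & f v0 = (p v0)%:C].
Proof.
move=> pD pZ.
have sp : sublinear p.
  by split=> // c x c0; apply: le_trans (pZ _ _) _; rewrite nrm_real ger0_norm.
have [u [uD uZ up uv0]] := real_hahn_banach p v0 sp.
have uN x : u (- x) = - u x.
  by have := uZ (-1) x; rewrite rmorphN /= scaleN1r mulN1r.
pose f x : R[i]^o := (u x -i* u ('i *: x)).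
have lf : linear f.
  move=> [a b] x y; rewrite /f.
  have aE : (a +i* b) = a%:C + b%:C * 'i :> R[i] by simpc.
  have uiZ (c : R) z : u ('i *: (c%:C *: z)) = c * u ('i *: z).
    by rewrite scalerA mulrC -scalerA uZ.
  have uii z : u ('i *: ('i *: z)) = - u z.
    by rewrite scalerA -expr2 sqr_i scaleN1r uN.
  rewrite {1 2}aE !scalerDl -!scalerA !scalerDr !uD !uZ !uiZ uii.
  apply/eqP; rewrite eq_complex /=; apply/andP; split; apply/eqP => /=; ring.
have fp x : nrm (f x) <= p x.
  have [fx0|fx0] := eqVneq (f x) 0.
    rewrite fx0 nrm0.
    have := pZ 0 x; have := sublinear_geN p sp x.
    have : p (- x) <= p x.
      have := pZ (-1)%:C x.
      by rewrite nrm_real normrN1 mul1r rmorphN /= scaleN1r.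
    lra.
  pose l : R[i] := (nrm (f x))%:C / f x.
  have nl : nrm (l : R[i]^o) = 1.
    by rewrite /nrm /l -nrmE normf_div normr_id divff // normr_eq0.
  have := up (l *: x).
  have -> : u (l *: x) = complex.Re (f (l *: x)) by [].
  have -> : f (l *: x) = l * f x.
    have f0 : f 0 = 0.
      by have := lf 1 0 0; rewrite !scale1r addr0 -{1}[f 0]addr0 => /addrI ->.
    by have := lf l x 0; rewrite !addr0 f0 addr0.
  rewrite /l mulfVK //= => /le_trans; apply.
  by apply: le_trans (pZ _ _) _; rewrite nl mul1r.
exists f; split=> //.
have := fp v0; rewrite /f uv0 => h.
have {}h : Num.sqrt (p v0 ^+ 2 + u ('i *: v0) ^+ 2) <= p v0.
  by move: h; rewrite /nrm normc_def /= sqrrN.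
have p0 : 0 <= p v0 by apply: le_trans h; exact: sqrtr_ge0.
have : u ('i *: v0) ^+ 2 <= 0.
  rewrite -(lerD2l (p v0 ^+ 2)) addr0 -ler_sqrt ?exprn_ge0 //.
  by rewrite [leRHS]sqrtr_sqr ger0_norm.
by rewrite real_exprn_even_le0 //= => /eqP ->; rewrite oppr0.
Qed.

(** * Density of ranges and norm attainment *)

Lemma nrm_bop {R : realType} {X Y : normedModType R[i]} (f : bop X Y) :
  nrm f = opnorm f.
Proof. by []. Qed.

Lemma unit_multiple {R : realType} {X : normedModType R[i]} (x : X) :
  x != 0 -> exists u : X, `|u| = 1 /\ x = (nrm x)%:C *: u.
Proof.
move=> x0; exists (`|x|^-1 *: x); rewrite normfZV //.
by rewrite -nrmE scalerA divff ?normr_eq0 // scale1r.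
Qed.

Lemma dual_hahn_banach {R : realType} {X : normedModType R[i]} (p : X -> R)
    (x0 : X) :
  (forall x y, p (x + y) <= p x + p y) ->
  (forall (l : R[i]) x, p (l *: x) <= nrm (l : R[i]^o) * p x) ->
  (forall x, p x <= nrm x) ->
  exists f : dual X, (forall x, nrm (f x) <= p x) /\ f x0 = (p x0)%:C.
Proof.
move=> pD pZ pn; have [f [lf fp fx0]] := seminorm_hahn_banach p x0 pD pZ.
have bf : `[< bounded_linear f >].
  apply/asboolP; split=> //; exists 1 => x.
  by rewrite mul1r !nrmE lecR; exact: le_trans (fp x) (pn x).
by exists (Bop bf).
Qed.

(** The distance to the range is a seminorm [p] below the norm.  A functional
    dominated by [p] annihilates the range, so if only the zero functional does
    that, then [p y = 0] for every [y]. *)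
Lemma dense_range {R : realType} {X Y : normedModType R[i]} (T : bop X Y) :
  (forall f : dual Y, (forall x, f (T x) = 0) -> f = 0) ->
  forall y e, 0 < e -> exists x, nrm (y - T x) < e.
Proof.
move=> annT y e e0.
pose E z := [set nrm (z - T x) | x in [set: X]]%classic.
have lbE z : has_lbound (E z) by exists 0 => _ [x _ <-]; exact: nrm_ge0.
have E0 z : (E z !=set0)%classic by exists (nrm (z - T 0)), 0.
pose p z := inf (E z).
have pT z x : p z <= nrm (z - T x) by apply: ge_inf => //; exists x.
have pn z : p z <= nrm z by have := pT z 0; rewrite linear0 subr0.
have [z w|l z|//|f [fp fy]] := dual_hahn_banach p y.
- rewrite -lerBlDr; apply: lb_le_inf => // _ [x _ <-].
  rewrite lerBlDr -lerBlDl; apply: lb_le_inf => // _ [x' _ <-].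
  rewrite lerBlDl; apply: le_trans (pT _ (x + x')) _.
  by rewrite linearD opprD addrACA; exact: nrmD.
- have [->|l0] := eqVneq l 0.
    by rewrite scale0r nrm0 mul0r -(nrm0 (V := Y)); exact: pn.
  have nl : 0 < nrm (l : R[i]^o) by rewrite nrm_gt0.
  rewrite -ler_pdivrMl //; apply: lb_le_inf => // _ [x _ <-].
  rewrite ler_pdivrMl // -nrmZ scalerBr -linearZ; exact: pT.
have f0 : f = 0.
  apply: annT => x; apply: nrm0_eq0; apply/eqP; rewrite eq_le nrm_ge0 andbT.
  by apply: le_trans (fp _) _; rewrite -(nrm0 (V := Y)) -(subrr (T x)).
have py : p y = 0 by apply: (@complexI R); rewrite -fy f0.
have [_ [x _ <-]] := inf_adherent e0 (conj (E0 y) (lbE y)).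
by rewrite -/(p y) py add0r; exists x.
Qed.

(** Smoothness supplies a norming functional at each unit vector; rescaling it
    by the norm shows that the set in which [duality_map] chooses is
    nonempty. *)
Lemma duality_mapP {R : realType} {X : normedModType R[i]} (x : X) :
  smooth_space X ->
  `|duality_map x| = `|x| /\ duality_map x x = `|x| ^+ 2.
Proof.
move=> smX; rewrite /duality_map; case: xgetP => [f _ //|/= noJ].
have [x0|x0] := eqVneq x 0.
  by have := noJ 0; rewrite x0 !normr0 expr0n; case.
have [u [u1 xu]] := unit_multiple x x0; have [f [[f1 fu] _]] := smX u u1.
case: (noJ (`|x| *: f)); split.
  by rewrite normrZ f1 normr_id mulr1.
rewrite {2}xu -nrmE linearZ /=.
by rewrite -[LHS]/(`|x| * (`|x| * f u)) fu mulr1.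
Qed.

Lemma duality_map_norming {R : realType} {X : normedModType R[i]} (x : X)
    (f : dual X) :
  smooth_space X -> `|x| = 1 -> `|f| = 1 -> f x = 1 -> duality_map x = f.
Proof.
move=> smX x1 f1 fx; have [g [_ gU]] := smX x x1.
have [Jn Jx] := duality_mapP x smX.
by rewrite -(gU f) // -(gU (duality_map x)) // Jn Jx x1 expr1n.
Qed.

Lemma functional_le {R : realType} {X : normedModType R[i]} (f : dual X) x :
  `|f x| <= `|f| * `|x|.
Proof. by rewrite !nrmE -rmorphM /= lecR nrm_bop opnormP. Qed.

(** A bidual functional [Phi] norming [f] is the evaluation at some [x], and
    [f x = Phi f] is the norm of [f].  The inequality [|x| <= |Phi|] comes from
    testing [Phi] on [J x], since [J x x = |x|^2] while [J x] has norm
    [|x|]. *)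
Lemma norm_attaining {R : realType} {X : normedModType R[i]} (f : dual X) :
  reflexive_space X -> smooth_space X -> `|f| = 1 ->
  exists x : X, `|x| = 1 /\ f x = 1.
Proof.
move=> reX smX f1.
have nf1 : nrm f = 1 by rewrite /nrm f1.
have [g h|l g|//|Phi [Phin Phif]] := dual_hahn_banach (@nrm R (dual X)) f.
- exact: nrmD.
- by rewrite nrmZ.
have [x Phix] := reX Phi; exists x.
have fx : f x = 1 by rewrite -Phix Phif nf1.
split=> //; apply/eqP; rewrite eq_le; apply/andP; split; last first.
  by have := functional_le f x; rewrite fx normr1 f1 mul1r.
have [Jn Jx] := duality_mapP x smX.
have := Phin (duality_map x); rewrite Phix Jx.
rewrite -lecR -nrmE -[X in _ <= X]nrmE Jn normrX normr_id expr2.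
have [->|x0] := eqVneq x 0; first by rewrite normr0.
by rewrite ger_pMl // normr_gt0.
Qed.

(** * Self-adjoint operators *)

Lemma selfadjoint_dense {R : realType} {X : normedModType R[i]} (T : bop X X) :
  reflexive_space X -> smooth_space X -> selfadjoint T ->
  (forall x, T x = 0 -> x = 0) ->
  forall y e, 0 < e -> exists x, nrm (y - T x) < e.
Proof.
move=> reX smX saT injT; apply: dense_range => f fT.
apply/eqP/negPn/negP => f0.
have [g [g1 fg]] := unit_multiple f f0.
have [x [x1 gx]] := norm_attaining g reX smX g1.
have JT : duality_map (T x) = 0.
  have /(congr1 (fun F => F x)) /= <- := saT.
  rewrite (duality_map_norming x g) //; apply/val_inj/funext => y /=.
  have := fT y; rewrite {1}fg -[_ (T y)]/((nrm f)%:C * g (T y)) => /eqP.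
  by rewrite mulf_eq0 -nrmE normr_eq0 (negbTE f0) => /eqP.
have /injT x0 : T x = 0.
  by apply: normr0_eq0; rewrite -(duality_mapP (T x) smX).1 JT normr0.
by move: x1; rewrite x0 normr0 => /eqP; rewrite eq_sym oner_eq0.
Qed.

Lemma selfadjoint_log_convex {R : realType} {X : normedModType R[i]}
    (T : bop X X) x :
  smooth_space X -> selfadjoint T ->
  nrm (T x) ^+ 2 <= nrm x * nrm (T (T x)).
Proof.
move=> smX saT; have [_ JTx] := duality_mapP (T x) smX.
have /(congr1 (fun F => F x)) /= TJ := saT.
have : `|duality_map (T x) (T x)| <= `|x| * `|T (T x)|.
  rewrite -TJ /=; apply: le_trans (functional_le _ _) _.
  by rewrite (duality_mapP x smX).1.
by rewrite JTx normrX normr_id !nrmE -rmorphXn -rmorphM /= lecR.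
Qed.

(** The bound on the last ratio propagates backwards, because the ratios of a
    log-convex sequence increase.  Zero terms are allowed, so ratios are written
    as products. *)
Lemma log_convex_growth {R : realFieldType} (a : nat -> R) (l : R) :
  (forall k, 0 <= a k) -> 0 <= l ->
  (forall k, a k.+1 ^+ 2 <= a k * a k.+2) ->
  forall n, a n.+1 <= l * a n -> a n.+1 <= l ^+ n.+1 * a 0%N.
Proof.
move=> a0 l0 acvx; elim=> [|n IHn] an; first by rewrite expr1.
have /IHn {}IHn : a n.+1 <= l * a n.
  have [->|an1] := eqVneq (a n.+1) 0; first by rewrite mulr_ge0.
  have an1p : 0 < a n.+1 by rewrite lt_neqAle eq_sym an1 a0.
  rewrite -(ler_pM2r an1p) -expr2; apply: le_trans (acvx n) _.
  by rewrite mulrAC [leRHS]mulrC ler_wpM2l.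
by apply: le_trans an _; rewrite exprS -mulrA ler_wpM2l.
Qed.

(** If [a ^+ n.+1 < b], the midpoint of [a] and the root of [b] is a value of
    [l] violating the hypothesis. *)
Lemma le_exprn_of_gt {R : realType} (a b : R) n :
  0 <= a -> 0 <= b -> (forall l, a < l -> b <= l ^+ n.+1) -> b <= a ^+ n.+1.
Proof.
move=> a0 b0 ble; pose r := b `^ (n.+1%:R^-1).
have r0 : 0 <= r by exact: powR_ge0.
have rK : r ^+ n.+1 = b.
  by rewrite -powR_mulrn // -powRrM mulVf ?pnatr_eq0 // powRr1.
rewrite leNgt -{1}rK ltr_pXn2r ?nnegrE //; apply/negP => ar.
have m0 : 0 <= (a + r) / 2 by rewrite divr_ge0 // addr_ge0.
have := ble _ (midf_lt ar).1.
by rewrite -rK ler_pXn2r ?nnegrE // leNgt (midf_lt ar).2.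
Qed.

(** * Minimum modulus *)

Lemma min_modulus_ge0 {R : realType} {X : normedModType R[i]} (T : bop X X) :
  0 <= min_modulus T.
Proof.
rewrite /min_modulus; set E := [set _ | _ in _]%classic.
have [->|E0] := eqVneq E set0; first by rewrite inf0.
by apply: lb_le_inf; [exact/set0P | move=> _ [x _ <-]; exact: nrm_ge0].
Qed.

Lemma min_modulusP {R : realType} {X : normedModType R[i]} (T : bop X X) x :
  min_modulus T * nrm x <= nrm (T x).
Proof.
have [->|x0] := eqVneq x 0; first by rewrite linear0 !nrm0 mulr0.
have [u [u1 xu]] := unit_multiple x x0.
rewrite {2}xu linearZ nrmZ mulrC.
rewrite nrm_real ger0_norm ?nrm_ge0 // ler_wpM2l ?nrm_ge0 //.
apply: ge_inf; last by exists u.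
by exists 0 => _ [y _ <-]; exact: nrm_ge0.
Qed.

(** The image of a dense set under a map with dense range is dense, by
    continuity: the error made inside [T] is amplified by at most
    [opnorm T + 1], where the 1 guards against a zero norm. *)
Lemma bop_exp_dense {R : realType} {X : normedModType R[i]} (T : bop X X) n :
  (forall y e, 0 < e -> exists x, nrm (y - T x) < e) ->
  forall y e, 0 < e -> exists x, nrm (y - bop_exp T n x) < e.
Proof.
move=> dT; elim: n => [|n IHn] y e e0; first by exists y; rewrite subrr nrm0.
have e2 : 0 < e / 2 by rewrite divr_gt0.
have [x yx] := dT y _ e2.
pose c := opnorm T + 1.
have T0 : 0 <= opnorm T by rewrite -nrm_bop nrm_ge0.
have c0 : 0 < c by rewrite ltr_wpDl.
have [z xz] := IHn x (e / 2 / c) (divr_gt0 e2 c0); exists z.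
have -> : y - bop_exp T n.+1 z = (y - T x) + T (x - bop_exp T n z).
  by rewrite linearB subrKA.
apply: le_lt_trans (nrmD _ _) _; rewrite [e]splitr ltrD //.
apply: le_lt_trans (opnormP _ _) _; move: xz; rewrite ltr_pdivlMr // => xz.
by apply: le_lt_trans xz; rewrite mulrC ler_wpM2l ?nrm_ge0 // lerDl.
Qed.

Lemma min_modulus_exp_ge {R : realType} {X : normedModType R[i]} (T : bop X X)
    n x : min_modulus T ^+ n * nrm x <= nrm (bop_exp T n x).
Proof.
elim: n => [|n IHn]; first by rewrite mul1r.
rewrite exprS -mulrA; apply: le_trans (min_modulusP T (bop_exp T n x)).
by rewrite ler_wpM2l // min_modulus_ge0.
Qed.

Lemma min_modulus_lt {R : realType} {X : normedModType R[i]} (T : bop X X)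
    (u : X) (l : R) :
  `|u| = 1 -> min_modulus T < l -> exists x, `|x| = 1 /\ nrm (T x) < l.
Proof.
move=> u1; rewrite -subr_gt0 => l0.
pose E := [set nrm (T x) | x in [set x : X | `|x| = 1]]%classic.
have [|_ [x /= x1 <-]] := inf_adherent l0 (E := E).
  split; first by exists (nrm (T u)), u.
  by exists 0 => _ [x _ <-]; exact: nrm_ge0.
by rewrite -/(min_modulus T) addrC subrK; exists x.
Qed.

(** Approximate a unit vector [x] with [|T x| < l] by [y = T^m z] in the range
    of [T^m]; by continuity of [T] and of the norm, [|T y| <= l * |y|] once [y]
    is close enough to [x]. *)
Lemma near_minimizer_in_range {R : realType} {X : normedModType R[i]}
    (T : bop X X) (u : X) (l : R) m :
  (forall y e, 0 < e -> exists x, nrm (y - T x) < e) ->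
  `|u| = 1 -> min_modulus T < l ->
  exists z, z != 0 /\ nrm (bop_exp T m.+1 z) <= l * nrm (bop_exp T m z).
Proof.
move=> dT u1 ml.
have [x [x1 xl]] := min_modulus_lt T u l u1 ml.
have Tx0 := nrm_ge0 (T x); have T0 : 0 <= opnorm T by rewrite -nrm_bop nrm_ge0.
have l0 : 0 < l by exact: le_lt_trans Tx0 xl.
(* With |x - y| < e one has |T y| <= |T x| + |T| e and |y| > 1 - e; this e
   makes |T x| + |T| e equal to l (1 - e). *)
pose c := opnorm T + l; have c0 : 0 < c by rewrite ltr_wpDl.
pose e := (l - nrm (T x)) / c.
have e0 : 0 < e by rewrite divr_gt0 // subr_gt0.
have nx1 : nrm x = 1 by rewrite /nrm x1.
have [z xz] := bop_exp_dense T m dT x e e0.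
set y := bop_exp T m z in xz *.
have eD : e * (opnorm T + l) = l - nrm (T x) by rewrite divfK ?gt_eqF.
have Ty : nrm (T y) <= nrm (T x) + opnorm T * e.
  have -> : T y = T x - T (x - y) by rewrite -linearB subKr.
  apply: le_trans (nrmD _ _) _; rewrite lerD2l /nrm normrN -/(nrm _).
  by apply: le_trans (opnormP _ _) _; rewrite ler_wpM2l // ltW.
have ny : 1 - e < nrm y.
  have := nrmD (x - y) y; rewrite subrK nx1; lra.
exists z; split; last first.
  apply: le_trans Ty _; apply: le_trans (_ : l * (1 - e) <= _); last first.
    by rewrite ler_pM2l // ltW.
  lra.
(* If z were 0, then y = 0 and e > 1, but e = (l - |T x|) / (|T| + l) <= 1. *)
apply/negP => /eqP z0; move: xz; rewrite /y z0 linear0 subr0 nx1 => e1.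
have : c < e * c by rewrite ltr_pMl.
rewrite eD /c; lra.
Qed.

Lemma min_modulus_exp_le {R : realType} {X : normedModType R[i]}
    (T : bop X X) (u : X) m :
  reflexive_space X -> smooth_space X -> selfadjoint T -> `|u| = 1 ->
  min_modulus (bop_exp T m.+1) <= min_modulus T ^+ m.+1.
Proof.
move=> reX smX saT u1.
have [injT|ninjT] := pselect (forall x, T x = 0 -> x = 0); last first.
  have [x [Tx0 x0]] : exists x, T x = 0 /\ x != 0.
    apply: contrapT => nx; apply: ninjT => x Tx0.
    by apply/eqP/negPn/negP => x0; apply: nx; exists x.
  have Tmx k : bop_exp T k.+1 x = 0.
    elim: k => [|k IHk] //.
    by rewrite -[LHS]/(T (bop_exp T k.+1 x)) IHk linear0.
  have nx0 : 0 < nrm x by rewrite nrm_gt0.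
  apply: le_trans (exprn_ge0 _ (min_modulus_ge0 T)).
  have := min_modulusP (bop_exp T m.+1) x.
  by rewrite Tmx nrm0 pmulr_lle0.
have dT := selfadjoint_dense T reX smX saT injT.
have lP l : min_modulus T < l -> min_modulus (bop_exp T m.+1) <= l ^+ m.+1.
  move=> ml; have [z [z0 zl]] := near_minimizer_in_range T u l m dT u1 ml.
  have l0 : 0 <= l by exact: le_trans (min_modulus_ge0 T) (ltW ml).
  have nz0 : 0 < nrm z by rewrite nrm_gt0.
  rewrite -(ler_pM2r nz0); apply: le_trans (min_modulusP _ _) _.
  apply: (log_convex_growth (fun k => nrm (bop_exp T k z))) => // k.
    exact: nrm_ge0.
  exact: (selfadjoint_log_convex T (bop_exp T k z)).
by apply: le_exprn_of_gt => //; exact: min_modulus_ge0.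
Qed.

Theorem theorem9 (R : realType) (X : completeNormedModType R[i])
    (T : bop X X) :
  reflexive_space X -> smooth_space X -> selfadjoint T ->
  forall n : nat, (0 < n)%N ->
    min_modulus (bop_exp T n) = min_modulus T ^+ n.
Proof.
move=> reX smX saT [|m] // _.
(* On the zero space both sides are infima of the empty set, and 0 = 0 ^+ n
   since n is positive. *)
have [[u u1]|nou] := pselect (exists u : X, `|u| = 1); last first.
  have mm0 (S : bop X X) : min_modulus S = 0.
    rewrite /min_modulus (_ : [set _ | _ in _]%classic = set0) ?inf0 //.
    by apply/seteqP; split=> // y [x x1 _]; case: nou; exists x.
  by rewrite !mm0 expr0n.
apply/eqP; rewrite eq_le (min_modulus_exp_le T u) //=.
apply: lb_le_inf; first by exists (nrm (bop_exp T m.+1 u)), u.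
move=> _ [x /= x1 <-]; have := min_modulus_exp_ge T m.+1 x.
by rewrite (_ : nrm x = 1) ?mulr1 // /nrm x1.
Qed.
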